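(* Let $M$ be a surface of revolution with profile function $m$ and slope metric $F=\frac{\alpha^2}{\alpha-\beta}$. A parallel $\mathcal{P}(s)=(u_0,v(s))$ (parametrized to have unit $F$-speed) is an $F$-geodesic if and only if $m'(u_0)=0$. Consequently, if the slope metric is strongly convex, then no parallel of $M$ is an $F$-geodesic.
   Context: Let $I\subset\mathbb{R}$ be an open interval and $m:I\to(0,\infty)$ smooth. The surface of revolution $M\to\mathbb{R}^3$ is $(u,v)\mapsto(m(u)\cos v,\,m(u)\sin v,\,u)$, $u\in I$, $v\in\mathbb{S}^1$. Its slope metric is $F=\frac{\alpha^2}{\alpha-\beta}$ (on tangent vectors with $\alpha>\beta$), with $\alpha=\sqrt{[1+(m')^2]\dot u^2+m^2\dot v^2}$, $\beta=\dot u$, in the canonical coordinates $(u,v,\dot u,\dot v)$ of $TM$; it is strongly convex when $\alpha>\beta$ and $\frac12\frac{\partial^2F^2}{\partial y^i\partial y^j}$ (with $(y^1,y^2)=(\dot u,\dot v)$) is positive definite on all nonzero tangent vectors. A parallel is a curve $u=u_0$ constant, $v=v(s)$. A unit speed $F$-geodesic is a curve with $F(\mathcal{P},\dot{\mathcal{P}})=1$ satisfying the Euler–Lagrange equations of $\frac12F^2$. *)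

(* Defs.v *)
From Stdlib Require Export Reals.
From Coquelicot Require Export Coquelicot.
Open Scope R_scope.

(* Open intervals have possibly infinite endpoints. *)
Definition in_itv (a b : Rbar) (x : R) : Prop := Rbar_lt a x /\ Rbar_lt x b.

Definition smooth_on (a b : Rbar) (f : R -> R) : Prop :=
  forall x, in_itv a b x -> forall n : nat, ex_derive_n f n x.

(* [m] is the profile of the surface (u, v) |-> (m u cos v, m u sin v, u) over
   the interval (a, b). *)
Definition profile (a b : Rbar) (m : R -> R) : Prop :=
  Rbar_lt a b /\ smooth_on a b m /\ (forall u, in_itv a b u -> 0 < m u).

(* Functions on the tangent bundle take the canonical coordinates
   (u, v, du, dv). The angle v in S^1 is represented by a real lift: every
   smooth curve in S^1 defined on an interval has a smooth lift, and nothing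
   below depends on the lift chosen. *)
Definition alpha (m : R -> R) (u v du dv : R) : R :=
  sqrt ((1 + Derive m u ^ 2) * du ^ 2 + m u ^ 2 * dv ^ 2).

Definition beta (u v du dv : R) : R := du.

(* The slope metric is only meaningful on tangent vectors in [slope_dom]; there
   alpha is positive, so that the metric is smooth and the total operator
   [Derive] below is applied to differentiable functions. *)
Definition slope_dom (m : R -> R) (u v du dv : R) : Prop :=
  alpha m u v du dv > beta u v du dv.

Definition slope_metric (m : R -> R) (u v du dv : R) : R :=
  alpha m u v du dv ^ 2 / (alpha m u v du dv - beta u v du dv).

(* [g F i j u v du dv] is half the derivative of F^2, taken i times in du and
   j times in dv; it is used with i + j = 2. *)
Definition g (F : R -> R -> R -> R -> R) (i j : nat) (u v du dv : R) : R :=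
  / 2 * partial_derive i j (fun y1 y2 => F u v y1 y2 ^ 2) du dv.

Definition fundamental_form (F : R -> R -> R -> R -> R)
    (u v du dv w1 w2 : R) : R :=
  g F 2 0 u v du dv * w1 * w1 + g F 1 1 u v du dv * w1 * w2
  + g F 1 1 u v du dv * w2 * w1 + g F 0 2 u v du dv * w2 * w2.

Definition strongly_convex (a b : Rbar) (m : R -> R) : Prop :=
  forall u v du dv, in_itv a b u -> (du, dv) <> (0, 0) ->
    slope_dom m u v du dv /\
    (forall w1 w2, (w1, w2) <> (0, 0) ->
       0 < fundamental_form (slope_metric m) u v du dv w1 w2).

(* Curves s |-> (cu s, cv s) on the surface, for s in (s0, s1). *)
Definition unit_speed_curve (a b : Rbar) (m : R -> R) (s0 s1 : Rbar)
    (cu cv : R -> R) : Prop :=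
  smooth_on s0 s1 cu /\ smooth_on s0 s1 cv /\
  forall s, in_itv s0 s1 s ->
    in_itv a b (cu s) /\
    slope_dom m (cu s) (cv s) (Derive cu s) (Derive cv s) /\
    slope_metric m (cu s) (cv s) (Derive cu s) (Derive cv s) = 1.

Definition euler_lagrange (L : R -> R -> R -> R -> R) (s0 s1 : Rbar)
    (cu cv : R -> R) : Prop :=
  forall s, in_itv s0 s1 s ->
    is_derive
      (fun t => Derive (fun y => L (cu t) (cv t) y (Derive cv t)) (Derive cu t))
      s
      (Derive (fun x => L x (cv s) (Derive cu s) (Derive cv s)) (cu s)) /\
    is_derive
      (fun t => Derive (fun y => L (cu t) (cv t) (Derive cu t) y) (Derive cv t))
      s
      (Derive (fun x => L (cu s) x (Derive cu s) (Derive cv s)) (cv s)).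

Definition half_square (F : R -> R -> R -> R -> R) (u v du dv : R) : R :=
  / 2 * F u v du dv ^ 2.

Definition unit_speed_geodesic (a b : Rbar) (m : R -> R) (s0 s1 : Rbar)
    (cu cv : R -> R) : Prop :=
  unit_speed_curve a b m s0 s1 cu cv /\
  euler_lagrange (half_square (slope_metric m)) s0 s1 cu cv.

(* Main.v *)
Require Import Defs.
From Stdlib Require Import Lra.

(** Along a parallel [du = 0], so [beta = 0] and the energy [L = F^2 / 2] reduces
    to [m(u)^2 dv^2 / 2] as a function of [u], [v] and [dv] ([energy_du0]).
    Its only non-classical partial derivative is the one in [du], transverse to
    the parallel: [alpha] is even in [du], so to first order
    [F = alpha / (1 - du / alpha) = alpha + du], whence [dL/d(du) = F dF/d(du) = F]
    ([is_derive_energy_du]).  Unit speed makes this momentum constantly [1], and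
    the [u]-equation becomes [0 = dL/du = m m' dv^2], that is [m' = 0], because
    [m] and [dv] do not vanish.  The [v]-equation says that [m(u0)^2 v'] is
    constant, which unit speed already forces: [v'^2 = 1 / m(u0)^2].

    For the last claim, strong convexity puts the direction of the meridian
    [(du, dv) = (1, 0)] into the domain [alpha > beta] of the metric, where it
    reads [sqrt (1 + m'^2) > 1]; hence [m'] has no zero. *)

Lemma locally_in_itv (a b : Rbar) (x : R) :
  in_itv a b x -> locally x (in_itv a b).
Proof.
intros [Ha Hb].
apply filter_and.
- exact (open_Rbar_gt a x Ha).
- exact (open_Rbar_lt b x Hb).
Qed.

Lemma in_itv_nonempty (a b : Rbar) : Rbar_lt a b -> exists x, in_itv a b x.
Proof.
unfold in_itv.
destruct a as [a| |], b as [b| |]; simpl; intros H; try easy.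
- exists ((a + b) / 2); lra.
- exists (a + 1); lra.
- exists (b - 1); lra.
- now exists 0.
Qed.

Lemma Rpow2_div_self (x : R) : x ^ 2 / x = x.
Proof.
destruct (Req_dec x 0) as [->|Hx].
- unfold Rdiv; ring.
- now field.
Qed.

Section Parallel.

Variable m : R -> R.

Lemma alpha_du0 (u v dv : R) : alpha m u v 0 dv = Rabs (m u * dv).
Proof.
unfold alpha.
rewrite <- sqrt_Rsqr_abs; f_equal; unfold Rsqr; ring.
Qed.

Lemma slope_metric_du0 (u v dv : R) :
  slope_metric m u v 0 dv = Rabs (m u * dv).
Proof.
unfold slope_metric, beta.
now rewrite alpha_du0, Rminus_0_r, Rpow2_div_self.
Qed.

Lemma energy_du0 (u v dv : R) :
  half_square (slope_metric m) u v 0 dv = / 2 * (m u * dv) ^ 2.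
Proof.
unfold half_square.
now rewrite slope_metric_du0, pow2_abs.
Qed.

(** The momentum transverse to a parallel is the speed: the even function
    [alpha] of [du] is stationary at [du = 0], so that only [- beta] in the
    denominator contributes. *)
Lemma is_derive_energy_du (u v dv : R) :
  m u * dv <> 0 ->
  is_derive (fun y => half_square (slope_metric m) u v y dv) 0
    (Rabs (m u * dv)).
Proof.
intros Hne.
assert (Hpos : 0 < m u ^ 2 * dv ^ 2).
{ rewrite <- Rpow_mult_distr; now apply pow2_gt_0. }
rewrite <- (alpha_du0 u v dv).
unfold half_square, slope_metric, alpha, beta.
set (A := 1 + Derive m u ^ 2).
set (B := m u ^ 2 * dv ^ 2) in *.
assert (Hsqrt : 0 < sqrt B) by now apply sqrt_lt_R0.
assert (HB : A * 0 ^ 2 + B = B) by ring.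
auto_derive; replace (A * (0 * (0 * 1)) + B) with B by ring.
- repeat split; lra.
- rewrite HB; field; lra.
Qed.

Lemma Derive_energy_u (u v dv : R) :
  ex_derive m u ->
  Derive (fun x => half_square (slope_metric m) x v 0 dv) u
  = m u * Derive m u * dv ^ 2.
Proof.
intros Hm.
rewrite (Derive_ext _ (fun x => / 2 * (m x * dv) ^ 2)).
2: intros x; apply energy_du0.
apply is_derive_unique; auto_derive; [easy|].
change (fun x => m x) with m; field.
Qed.

Lemma Derive_energy_dv (u v dv : R) :
  Derive (fun y => half_square (slope_metric m) u v 0 y) dv = m u ^ 2 * dv.
Proof.
rewrite (Derive_ext _ (fun y => / 2 * (m u * y) ^ 2)).
2: intros y; apply energy_du0.
apply is_derive_unique; auto_derive; [easy | field].
Qed.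

Lemma Derive_energy_v (u v dv : R) :
  Derive (fun x => half_square (slope_metric m) u x 0 dv) v = 0.
Proof.
rewrite (Derive_ext _ (fun _ => / 2 * (m u * dv) ^ 2)).
- apply Derive_const.
- intros x; apply energy_du0.
Qed.

Variables (a b s0 s1 : Rbar) (u0 : R) (v : R -> R).
Hypothesis parallel : unit_speed_curve a b m s0 s1 (fun _ => u0) v.

Lemma parallel_speed (s : R) :
  in_itv s0 s1 s -> Rabs (m u0 * Derive v s) = 1.
Proof.
intros Hs.
destruct parallel as (_ & _ & Hc).
destruct (Hc s Hs) as (_ & _ & HF).
now rewrite Derive_const, slope_metric_du0 in HF.
Qed.

Lemma parallel_speed_neq0 (s : R) :
  in_itv s0 s1 s -> m u0 * Derive v s <> 0.
Proof.
intros Hs H0.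
generalize (parallel_speed s Hs).
rewrite H0, Rabs_R0; lra.
Qed.

(** Differentiating [(m(u0) v')^2 = 1] gives [2 m(u0)^2 v' v'' = 0], and [v']
    does not vanish. *)
Lemma parallel_acceleration (s : R) :
  in_itv s0 s1 s -> is_derive (Derive v) s 0.
Proof.
intros Hs.
assert (Hex : ex_derive (Derive v) s).
{ destruct parallel as (_ & Hv & _); exact (Hv s Hs 2%nat). }
assert (Hconst : is_derive (fun t => (m u0 * Derive v t) ^ 2) s 0).
{ apply is_derive_ext_loc with (fun _ => 1).
  - generalize (locally_in_itv _ _ _ Hs); apply filter_imp; intros t Ht.
    now rewrite <- pow2_abs, (parallel_speed t Ht), pow1.
  - apply (is_derive_const (K := R_AbsRing) (V := R_NormedModule)). }
assert (Hchain : is_derive (fun t => (m u0 * Derive v t) ^ 2) s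
                   (2 * m u0 * (m u0 * Derive v s) * Derive (Derive v) s)).
{ generalize (Derive_correct _ _ Hex).
  generalize (Derive (Derive v) s).
  generalize (Derive v); intros w l Hw.
  replace (2 * m u0 * (m u0 * w s) * l)
    with (INR 2 * (m u0 * l) * (m u0 * w s) ^ 1) by (simpl; ring).
  apply (is_derive_pow (fun t => m u0 * w t) 2 s (m u0 * l)).
  now apply is_derive_scal. }
assert (Hzero : 2 * m u0 * (m u0 * Derive v s) * Derive (Derive v) s = 0).
{ rewrite <- (is_derive_unique _ _ _ Hchain).
  now apply is_derive_unique. }
replace 0 with (Derive (Derive v) s); [now apply Derive_correct|].
generalize (parallel_speed_neq0 s Hs); intros Hne.
apply Rmult_integral in Hzero; destruct Hzero as [Hzero|]; [|easy].
exfalso; apply Hne.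
apply Rmult_integral in Hzero; destruct Hzero as [Hzero|]; [|easy].
replace (m u0) with 0 by lra; ring.
Qed.

Lemma parallel_momentum_u (s : R) :
  in_itv s0 s1 s ->
  is_derive
    (fun t => Derive (fun y => half_square (slope_metric m)
                                 u0 (v t) y (Derive v t)) 0) s 0.
Proof.
intros Hs.
apply is_derive_ext_loc with (fun _ => 1).
- generalize (locally_in_itv _ _ _ Hs); apply filter_imp; intros t Ht.
  rewrite <- (parallel_speed t Ht); symmetry; apply is_derive_unique.
  now apply is_derive_energy_du, parallel_speed_neq0.
- apply (is_derive_const (K := R_AbsRing) (V := R_NormedModule)).
Qed.

Lemma parallel_momentum_v (s : R) :
  in_itv s0 s1 s ->
  is_derive
    (fun t => Derive (fun y => half_square (slope_metric m)
                                 u0 (v t) 0 y) (Derive v t)) s 0.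
Proof.
intros Hs.
apply is_derive_ext with (fun t => m u0 ^ 2 * Derive v t).
- intros t; symmetry; apply Derive_energy_dv.
- replace 0 with (m u0 ^ 2 * 0) by ring.
  now apply is_derive_scal, parallel_acceleration.
Qed.

Lemma parallel_geodesic_iff :
  ex_derive m u0 -> Rbar_lt s0 s1 ->
  (unit_speed_geodesic a b m s0 s1 (fun _ => u0) v <-> Derive m u0 = 0).
Proof.
intros Hm Hlt; split.
- intros [_ HEL].
  destruct (in_itv_nonempty _ _ Hlt) as [s Hs].
  destruct (HEL s Hs) as [Hu _].
  rewrite Derive_const, (Derive_energy_u _ _ _ Hm) in Hu.
  apply (is_derive_ext _ (fun t => Derive (fun y => half_square (slope_metric m)
                                 u0 (v t) y (Derive v t)) 0)) in Hu.
  2: intros t; now rewrite Derive_const.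
  apply is_derive_unique in Hu.
  rewrite (is_derive_unique _ _ _ (parallel_momentum_u s Hs)) in Hu.
  generalize (parallel_speed_neq0 s Hs); intros Hne.
  destruct (Req_dec (Derive m u0) 0) as [|Hm']; [easy|].
  exfalso.
  assert (Hprod : (m u0 * Derive v s) * (Derive m u0 * Derive v s) = 0)
    by (rewrite Hu; ring).
  apply Rmult_integral in Hprod; destruct Hprod as [|Hprod]; [easy|].
  apply Rmult_integral in Hprod; destruct Hprod as [|Hv]; [easy|].
  apply Hne; rewrite Hv; ring.
- intros Hm0; split; [exact parallel|].
  intros s Hs; rewrite !Derive_const; split.
  + rewrite (Derive_energy_u _ _ _ Hm), Hm0, Rmult_0_r, Rmult_0_l.
    apply is_derive_ext with (2 := parallel_momentum_u s Hs).
    intros t; now rewrite Derive_const.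
  + rewrite Derive_energy_v.
    apply is_derive_ext with (2 := parallel_momentum_v s Hs).
    intros t; now rewrite Derive_const.
Qed.

End Parallel.

(** If [m'(u) = 0], the meridian direction [(1, 0)] has [alpha = beta = 1] and
    lies outside the domain of the metric. *)
Lemma strongly_convex_Derive_neq0 (a b : Rbar) (m : R -> R) (u : R) :
  strongly_convex a b m -> in_itv a b u -> Derive m u <> 0.
Proof.
intros Hsc Hu Hm0.
destruct (Hsc u 0 1 0 Hu) as [Hdom _].
- intros H; injection H; lra.
- revert Hdom; unfold slope_dom, alpha, beta; rewrite Hm0.
  replace ((1 + 0 ^ 2) * 1 ^ 2 + m u ^ 2 * 0 ^ 2) with 1 by ring.
  rewrite sqrt_1; lra.
Qed.

Theorem proposition4p10 (a b : Rbar) (m : R -> R) (hm : profile a b m) :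
  (forall (u0 : R) (s0 s1 : Rbar) (v : R -> R),
     in_itv a b u0 -> Rbar_lt s0 s1 ->
     unit_speed_curve a b m s0 s1 (fun _ => u0) v ->
     (unit_speed_geodesic a b m s0 s1 (fun _ => u0) v <-> Derive m u0 = 0))
  /\
  (strongly_convex a b m ->
   forall (u0 : R) (s0 s1 : Rbar) (v : R -> R),
     in_itv a b u0 -> Rbar_lt s0 s1 ->
     unit_speed_curve a b m s0 s1 (fun _ => u0) v ->
     ~ unit_speed_geodesic a b m s0 s1 (fun _ => u0) v).
Proof.
assert (Hiff : forall (u0 : R) (s0 s1 : Rbar) (v : R -> R),
     in_itv a b u0 -> Rbar_lt s0 s1 ->
     unit_speed_curve a b m s0 s1 (fun _ => u0) v ->
     (unit_speed_geodesic a b m s0 s1 (fun _ => u0) v <-> Derive m u0 = 0)).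
{ intros u0 s0 s1 v Hu Hlt Hpar.
  apply parallel_geodesic_iff; try easy.
  destruct hm as (_ & Hsm & _); exact (Hsm u0 Hu 1%nat). }
split; [exact Hiff|].
intros Hsc u0 s0 s1 v Hu Hlt Hpar Hgeo.
apply (strongly_convex_Derive_neq0 _ _ _ _ Hsc Hu).
now apply (Hiff u0 s0 s1 v Hu Hlt Hpar).
Qed.
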